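(* Let $\rho(n)=2^{-n}\sum_{f\in\mathbb{F}_2[x],\ \deg(f)=n}\tau(f)$ and $\rho_0(n)=2^{-n}\sum_{f\in\mathbb{F}_2[x],\ \deg(f)=n}\tau_0(f)$. Then $\lim_{n\to\infty}\frac{\rho(n)}{n}=2$ and $\lim_{n\to\infty}\frac{\rho_0(n)}{n}=3$.
   Context: Define $T:\mathbb{F}_2[x]\to\mathbb{F}_2[x]$ by $T(f)=\frac{f}{x+1}$ if $f(1)=0$ and $T(f)=\frac{xf+1}{x+1}$ if $f(1)=1$. For nonzero $f\in\mathbb{F}_2[x]$, $\tau(f)$ is the least $k\in\mathbb{N}$ with $T^k(f)=1$. Define the polynomial Collatz map $T_0:\mathbb{F}_2[x]\to\mathbb{F}_2[x]$ by $T_0(f)=\frac{f}{x}$ if $f(0)=0$ and $T_0(f)=(x+1)f+1$ if $f(0)=1$; for nonzero $f$, $\tau_0(f)$ is the least $k\in\mathbb{N}$ with $T_0^k(f)=1$. (These stopping times are finite.) *)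

(* Defs.v *)
From HB Require Import structures.
From mathcomp Require Import all_boot all_order all_algebra.
From mathcomp Require Import boolp classical_sets reals topology normedtype sequences.
Set Implicit Arguments. Unset Strict Implicit. Unset Printing Implicit Defensive.
Import Order.TTheory GRing.Theory Num.Theory.
Local Open Scope ring_scope.

Notation F2poly := {poly 'F_2}.

(* T(f) = f/(x+1) if f(1)=0, (x f + 1)/(x+1) if f(1)=1 (exact divisions) *)
Definition T (f : F2poly) : F2poly :=
  if f.[1] == 0 then f %/ ('X + 1) else ('X * f + 1) %/ ('X + 1).

Definition T0 (f : F2poly) : F2poly :=
  if f.[0] == 0 then f %/ 'X else ('X + 1) * f + 1.

(* least k with (iter k g f) = 1; 0 if no such k exists (never happens for f != 0) *)
Definition stop_time (g : F2poly -> F2poly) (f : F2poly) : nat :=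
  match pselect (exists k, iter k g f == 1) with
  | left H => ex_minn H
  | right _ => 0%N
  end.

Definition tau := stop_time T.
Definition tau0 := stop_time T0.

(* the degree-n polynomial x^n + sum_{i<n} c_i x^i ; these enumerate all
   polynomials of degree exactly n over F_2 bijectively *)
Definition monic_of (n : nat) (c : {ffun 'I_n -> 'F_2}) : F2poly :=
  'X^n + \sum_(i < n) c i *: 'X^i.

Definition rho_gen (R : realType) (st : F2poly -> nat) (n : nat) : R :=
  (2%:R ^+ n)^-1 * \sum_(c : {ffun 'I_n -> 'F_2}) (st (monic_of c))%:R.

Definition rho (R : realType) := rho_gen R tau.
Definition rho0 (R : realType) := rho_gen R tau0.

(* Main.v *)
Require Import Defs.
From HB Require Import structures.
From mathcomp Require Import all_boot all_order all_algebra.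
From mathcomp Require Import boolp classical_sets reals topology normedtype sequences.
From mathcomp Require Import zify ring lra.
Import Order.TTheory GRing.Theory Num.Theory numFieldNormedType.Exports.
Local Open Scope ring_scope.

(** Put [y = x + 1] and call a step of [T] odd or even according to [f(1)].
    An even step lowers the degree by one and an odd step preserves it, so
    [tau f] is [deg f] plus the number of odd steps, and the claim on [rho] is
    that on average there are about as many odd as even steps.

    After [k] steps, [o] of them odd, [y^k T^k(f) = x^o f + c] with
    [deg c < k].  Hence the first [m] parities determine [f] modulo [y^m], and
    [T^k(f)], when of degree [d], determines [f] up to its [n - d] low
    [y]-digits.  So on [{f : deg f = n, deg T^k(f) = d}] the [d] parities
    starting at time [k], together with the first [n - d] parities, form an
    injective code in [{0,1}^n].  By Chernoff's bound the [L <= d] steps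
    following time [k] are unbalanced with exponentially small probability,
    and as the orbit has length at most [(n + 1)^2], a union bound over [k]
    and [d] applies with [L] of order [n^(1/3)].  If all blocks are balanced,
    then [tau f = 2 n + o(n)]; the exceptional [f] are too few to matter.

    Finally, substituting [x + 1] for [x] conjugates an even step of [T] to one
    step of [T0] and an odd step to two, so that
    [tau0 (f(x + 1)) + deg f = 2 tau f] and [rho0 n = 2 rho n - n]. *)

(** * Parities and degrees along an orbit *)

Definition deg (f : F2poly) : nat := (size f).-1.

Definition odd_at1 (f : F2poly) : bool := f.[1] != 0.

Definition odd_count k f : nat := \sum_(i < k) odd_at1 (iter i T f).
Definition even_count k f : nat := \sum_(i < k) ~~ odd_at1 (iter i T f).

Lemma F2_neq0 (a : 'F_2) : a != 0 -> a = 1.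
Proof. by case: a => [[|[|m]] //= ?] _; apply: val_inj. Qed.

Lemma F2_addxx (a : 'F_2) : a + a = 0.
Proof. by case: a => [[|[|m]] //= ?]; apply: val_inj. Qed.

Lemma F2poly_addpp (p : F2poly) : p + p = 0.
Proof. by apply/polyP=> i; rewrite coefD coef0 F2_addxx. Qed.

Lemma F2poly_oppE (p : F2poly) : - p = p.
Proof. by apply/eqP; rewrite eq_sym -subr_eq0 opprK F2poly_addpp. Qed.

Lemma X1E : 'X + 1 = 'X - 1%:P :> F2poly.
Proof. by rewrite F2poly_oppE. Qed.

Lemma size_X1 : size ('X + 1 : F2poly) = 2%N.
Proof. by rewrite X1E size_XsubC. Qed.

Lemma X1_neq0 : 'X + 1 != 0 :> F2poly.
Proof. by rewrite -size_poly_eq0 size_X1. Qed.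

(** Both divisions in [T] are exact, since the dividend vanishes at 1. All later arguments use this
    product form instead of the quotients. *)
Lemma T_mul f : ('X + 1) * T f = if odd_at1 f then 'X * f + 1 else f.
Proof.
rewrite /T /odd_at1; case: eqP => [f0|/eqP/F2_neq0 f1] /=; rewrite mulrC divpK //.
  by rewrite X1E dvdp_XsubCl; apply/rootP.
by rewrite X1E dvdp_XsubCl; apply/rootP; rewrite !hornerE f1 F2_addxx.
Qed.

Lemma T_neq0 f : f != 0 -> T f != 0.
Proof.
apply: contraNneq => Tf; have := T_mul f; rewrite Tf mulr0.
case: ifP => [o|_ <- //] /(congr1 (fun p : F2poly => p.[0])).
by rewrite !hornerE => /eqP; rewrite eq_sym oner_eq0.
Qed.

Lemma size_deg (f : F2poly) : f != 0 -> size f = (deg f).+1.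
Proof. by rewrite -size_poly_gt0 /deg => /prednK. Qed.

Lemma deg_T f : f != 0 -> deg f = (deg (T f) + ~~ odd_at1 f)%N.
Proof.
move=> f0; have : deg (('X + 1) * T f) = (deg (T f)).+1.
  by rewrite /deg size_mul ?X1_neq0 ?T_neq0 // size_X1 (size_deg _ (T_neq0 _ f0)).
rewrite T_mul; case: odd_at1 => /= [|->]; last by rewrite addn1.
by rewrite /deg mulrC -[1]/(1%:P) size_MXaddC (negPf f0) /= (size_deg _ f0) addn0 => -[].
Qed.

Lemma iter_T_neq0 k f : f != 0 -> iter k T f != 0.
Proof. by move=> f0; elim: k => //= k; apply: T_neq0. Qed.

Lemma deg_iter_T k f : f != 0 -> deg f = (deg (iter k T f) + even_count k f)%N.
Proof.
move=> f0; elim: k => [|k IH]; first by rewrite /even_count big_ord0 addn0.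
rewrite /even_count big_ord_recr /= {1}IH (deg_T (iter k T f)) ?iter_T_neq0 //.
by rewrite addnAC addnA.
Qed.

Lemma leq_deg_iter_T k f : f != 0 -> (deg (iter k T f) <= deg f)%N.
Proof. by move=> f0; rewrite (deg_iter_T k f f0) leq_addr. Qed.

Lemma odd_even_count k f : (odd_count k f + even_count k f = k)%N.
Proof.
rewrite /odd_count /even_count -big_split /= -[RHS]card_ord -sum1_card.
by apply: eq_bigr => i _; case: odd_at1.
Qed.

(** An even step keeps [c]; an odd step replaces it by ['X * c + ('X + 1) ^+ k], again of size at
    most [k + 1]. *)
Lemma iter_T_euclid k f : exists2 c : F2poly, (size c <= k)%N &
  ('X + 1) ^+ k * iter k T f = 'X^(odd_count k f) * f + c.
Proof.
elim: k => [|k [c sc IH]].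
  by exists 0; rewrite ?size_poly0 // /odd_count big_ord0 !expr0 addr0.
have step : ('X + 1) ^+ k.+1 * iter k.+1 T f =
    ('X + 1) ^+ k * (('X + 1) * T (iter k T f)) by rewrite exprSr -mulrA.
have -> : odd_count k.+1 f = (odd_count k f + odd_at1 (iter k T f))%N.
  by rewrite /odd_count big_ord_recr.
rewrite step T_mul; case: odd_at1; last first.
  by exists c; rewrite ?addn0 // (leq_trans sc).
exists ('X * c + ('X + 1) ^+ k).
  have sX : (size ('X * c : F2poly)%R <= k.+1)%N.
    by rewrite (leq_trans (size_polyMleq _ _)) // size_polyX.
  have sY : (size (('X + 1) ^+ k : F2poly)%R <= k.+1)%N.
    by rewrite (leq_trans (size_poly_exp_leq _ _)) // size_X1 mul1n.
  by rewrite (leq_trans (size_polyD _ _)) // geq_max sX sY.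
by rewrite mulrDr mulr1 mulrCA IH addn1 exprS mulrDr mulrA addrA.
Qed.

Lemma coprimep_X1X k : coprimep (('X + 1) ^+ k) ('X : F2poly).
Proof. by rewrite coprimep_expl // coprimepX /root !hornerE oner_eq0. Qed.

(** By induction the later parities give [T f = T g] modulo [('X + 1) ^+ m]. Multiplying by ['X + 1]
    gains one power, and in the odd case the factor ['X] is cancelled because it is coprime to
    ['X + 1]. *)
Lemma parity_dvdp m f g :
  (forall i, (i < m)%N -> odd_at1 (iter i T f) = odd_at1 (iter i T g)) ->
  ('X + 1) ^+ m %| f - g.
Proof.
elim: m f g => [|m IH] f g eqp; first by rewrite expr0 dvd1p.
have dT : ('X + 1) ^+ m %| T f - T g.
  by apply: IH => i im; rewrite -!iterSr eqp.
have : ('X + 1) ^+ m.+1 %| ('X + 1) * T f - ('X + 1) * T g.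
  by rewrite -mulrBr exprS dvdp_mul.
have := eqp 0%N isT; rewrite /= !T_mul => <-; case: odd_at1 => //.
have -> : 'X * f + 1 - ('X * g + 1) = 'X * (f - g)  :> F2poly.
  by rewrite opprD addrACA subrr addr0 mulrBr.
by rewrite Gauss_dvdpr // coprimep_X1X.
Qed.

Lemma dvdp_X1_small m (p : F2poly) : ('X + 1) ^+ m %| p -> (size p <= m)%N -> p = 0.
Proof.
move=> dp sp; apply/eqP; apply: contraLR sp => p0; rewrite -ltnNge.
have := dvdp_leq p0 dp.
by rewrite X1E size_exp_XsubC.
Qed.

Lemma F2_lead (f : F2poly) : f != 0 -> f`_(deg f) = 1.
Proof.
by move=> f0; apply: F2_neq0; rewrite -[f`__]/(lead_coef f) lead_coef_eq0.
Qed.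

Lemma size_sub_same_degree d (f g : F2poly) :
  f != 0 -> g != 0 -> deg f = d -> deg g = d -> (size (f - g)%R <= d)%N.
Proof.
move=> f0 g0 df dg; apply/leq_sizeP => j; rewrite leq_eqVlt => /predU1P[<-|dj].
  by rewrite coefB -{1}df -dg !F2_lead // subrr.
by rewrite coefB !nth_default ?subr0 // size_deg // ?df ?dg.
Qed.

(* Only the low [n - d] digits of [f] are lost in [iter k T f]; they are
   recovered from the first [n - d] parities. *)
Lemma parity_word_inj n d k (f g : F2poly) :
  f != 0 -> g != 0 -> deg f = n -> deg g = n ->
  deg (iter k T f) = d -> deg (iter k T g) = d ->
  (forall i, (i < d)%N ->
     odd_at1 (iter (k + i) T f) = odd_at1 (iter (k + i) T g)) ->
  (forall i, (i < n - d)%N -> odd_at1 (iter i T f) = odd_at1 (iter i T g)) ->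
  f = g.
Proof.
move=> f0 g0 df dg dTf dTg hi lo.
have Tfg : iter k T f = iter k T g.
  apply/eqP; rewrite -subr_eq0; apply/eqP/(dvdp_X1_small d).
    by apply: parity_dvdp => i id; rewrite -!iterD ![(i + k)%N]addnC hi.
  by apply: size_sub_same_degree; rewrite ?iter_T_neq0.
have := deg_iter_T k f f0; have := deg_iter_T k g g0.
have := odd_even_count k f; have := odd_even_count k g.
have [c sc Ec] := iter_T_euclid k f; have [c' sc' Ec'] := iter_T_euclid k g.
rewrite df dg dTf dTg => oeg oef eg ef.
have eqo : odd_count k g = odd_count k f by lia.
apply/eqP; rewrite -subr_eq0; apply/eqP/(dvdp_X1_small (n - d)).
  exact: parity_dvdp.
have [->|fg0] := eqVneq (f - g) 0; first by rewrite size_poly0.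
have XX : 'X^(odd_count k f) * (f - g) = c' - c.
  apply/eqP; rewrite mulrBr subr_eq addrAC eq_sym subr_eq addrC -Ec -eqo -Ec'.
  by rewrite Tfg.
(* Cancelling the power of ['X] leaves size at most [k] minus the number of odd steps. This is the
   number of even steps, [n - d]. *)
have : (size ('X^(odd_count k f) * (f - g))%R <= k)%N.
  by rewrite XX (leq_trans (size_polyD _ _)) // size_polyN geq_max sc sc'.
rewrite size_monicM ?monicXn // size_polyXn addSn /= => sk.
by rewrite -(leq_add2l (odd_count k f)) (leq_trans sk) //; lia.
Qed.

(** * A quadratic bound on the stopping time *)

Definition stops (g : F2poly -> F2poly) f := exists k, iter k g f == 1.

Lemma stop_time1 g : stop_time g 1 = 0%N.
Proof.
rewrite /stop_time; case: pselect => // H; case: ex_minnP => m _ mmin.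
by apply/eqP; rewrite -leqn0 mmin.
Qed.

Lemma stop_timeS g f : f != 1 -> stops g (g f) ->
  stops g f /\ stop_time g f = (stop_time g (g f)).+1.
Proof.
move=> f1 H; have [k Hk] := H.
have Hf : stops g f by exists k.+1; rewrite iterSr.
split=> //; rewrite /stop_time; case: pselect => // Hf'; case: pselect => // Hg.
case: ex_minnP => -[|m] m1 mmin; first by rewrite /= (negPf f1) in m1.
case: ex_minnP => p p1 pmin; congr _.+1; apply/eqP; rewrite eqn_leq pmin -?iterSr //.
by rewrite -ltnS mmin // iterSr.
Qed.

Lemma deg0_eq1 f : f != 0 -> deg f = 0%N -> f = 1.
Proof.
move=> f0 df; have := size_deg _ f0; rewrite df => sf.
have /size_poly1P[c c0 ->] : size f == 1%N by rewrite sf.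
by rewrite (F2_neq0 _ c0).
Qed.

Lemma odd_at1_add1 f : odd_at1 f = ('X + 1 %| f + 1).
Proof.
rewrite X1E dvdp_XsubCl /root hornerD hornerC /odd_at1.
have [->|/F2_neq0 ->] := eqVneq f.[1] 0; first by rewrite add0r oner_eq0.
by rewrite F2_addxx eqxx.
Qed.

(* Each odd step lowers the multiplicity of ['X + 1] in [f + 1] by one, which bounds
   the length of a run of odd steps. *)
Lemma T_odd_add1 f : odd_at1 f -> ('X + 1) * (T f + 1) = 'X * (f + 1).
Proof.
move=> o; rewrite mulrDr T_mul o !mulrDr !mulr1 -!addrA; congr (_ + _).
by rewrite addrCA F2poly_addpp addr0.
Qed.

(** Each odd step trades one factor ['X + 1] of [f + 1] for a factor ['X]. After [r] of them the
    cofactor is still prime to ['X + 1], so the next step is even. *)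
Lemma drop_odd_run r f h : f != 0 -> f + 1 = ('X + 1) ^+ r * h -> ~~ ('X + 1 %| h) ->
  deg f = deg (iter r T f) /\ ~~ odd_at1 (iter r T f).
Proof.
elim: r f h => [|r IH] f h f0 fh hnd.
  by split; rewrite //= odd_at1_add1 fh expr0 mul1r.
have of_ : odd_at1 f by rewrite odd_at1_add1 fh exprS -mulrA dvdp_mulIl.
have E : T f + 1 = ('X + 1) ^+ r * ('X * h).
  apply: (mulfI X1_neq0); rewrite T_odd_add1 // fh exprS mulrCA -!mulrA.
  by congr (_ * _); rewrite mulrCA.
rewrite iterSr (deg_T _ f0) of_ addn0; apply: IH E _; first exact: T_neq0.
rewrite Gauss_dvdpr //; have := coprimepX ('X + 1 : F2poly).
by rewrite /root !hornerE oner_eq0.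
Qed.

Lemma deg_drop f : (0 < deg f)%N ->
  exists r, [/\ (r <= deg f)%N, deg (iter r T f) = deg f &
                deg (iter r.+1 T f) = (deg f).-1].
Proof.
move=> df; have f0 : f != 0.
  by apply: contraTneq df => ->; rewrite /deg size_poly0.
have f1 : f + 1 != 0.
  apply: contraTneq df => /eqP; rewrite addr_eq0 F2poly_oppE => /eqP ->.
  by rewrite /deg size_poly1.
(* The run length [r] is the multiplicity of ['X + 1] in [f + 1], which is at most [deg f]. *)
have [r [h /implyP/(_ f1) hr E]] := multiplicity_XsubC (f + 1) 1.
have fh : f + 1 = ('X + 1) ^+ r * h by rewrite E mulrC -X1E.
have hnd : ~~ ('X + 1 %| h) by rewrite X1E dvdp_XsubCl.
have [dr er] := drop_odd_run r f h f0 fh hnd.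
exists r; split=> //; last first.
  have := deg_T _ (iter_T_neq0 r f f0); rewrite -dr er addn1 /= => ->.
  by [].
have h0 : h != 0 by apply: contraNneq hnd => ->; rewrite dvdp0.
have : (size (f + 1)%R <= (deg f).+1)%N.
  by rewrite (leq_trans (size_polyD _ _)) // geq_max size_poly1 (size_deg _ f0) leqnn.
rewrite fh size_mul ?expf_neq0 ?X1_neq0 // X1E size_exp_XsubC (size_deg _ h0).
by rewrite addnS /= => H; rewrite -ltnS (leq_trans _ H) // leq_addr.
Qed.

Lemma stop_time_iter k f : (forall i, (i < k)%N -> iter i T f != 1) ->
  stops T (iter k T f) -> stops T f /\ tau f = (k + tau (iter k T f))%N.
Proof.
elim: k f => [|k IH] f ne1; first by rewrite add0n.
rewrite iterSr => H.
have [|s t] := IH (T f) _ H; first by move=> i ik; rewrite -iterSr ne1.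
have [s' t'] := stop_timeS T f (ne1 0%N isT) s.
by split=> //; rewrite /tau in t *; rewrite t' t addSn.
Qed.

(** The degree never increases, so it stays 0 once the orbit has met 1. *)
Lemma deg_iter_ne1 k f : f != 0 -> (0 < deg (iter k T f))%N ->
  forall i, (i <= k)%N -> iter i T f != 1.
Proof.
move=> f0 dk i ik; apply: contraTneq dk => E.
have := deg_iter_T (k - i) _ (iter_T_neq0 i f f0).
rewrite -iterD subnK // E {1}/deg size_poly1 /=; lia.
Qed.

(** Lowering the degree by one costs at most [deg f + 1] steps, and these costs are summed down to
    degree 0. Termination comes from the same induction. *)
Lemma tau_bound f : f != 0 -> stops T f /\ (tau f <= (deg f).+1 ^ 2)%N.
Proof.
have [n] := ubnP (deg f); elim: n f => // n IH f dn f0.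
have [d0|dpos] := posnP (deg f).
  rewrite (deg0_eq1 _ f0 d0); split; first by exists 0%N.
  by rewrite /tau stop_time1.
have [r [rd dr0 dr]] := deg_drop f dpos.
have [s t] : stops T (iter r.+1 T f) /\
    (tau (iter r.+1 T f) <= (deg (iter r.+1 T f)).+1 ^ 2)%N.
  by apply: IH; rewrite ?iter_T_neq0 // dr prednK // -ltnS.
have d' : (0 < deg (iter r T f))%N by rewrite dr0.
have [s' t'] := stop_time_iter r.+1 f (fun i ir => deg_iter_ne1 r f f0 d' i ir) s.
split=> //; rewrite t'; move: t; rewrite dr prednK // => t.
rewrite (leq_trans (leq_add (leqnn _) t)) //; nia.
Qed.

Lemma iter_tau f : f != 0 -> iter (tau f) T f = 1.
Proof.
move=> f0; have [s _] := tau_bound f f0.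
by rewrite /tau /stop_time; case: pselect => [H|[]//]; case: ex_minnP => m /eqP.
Qed.

(** * Unbalanced words *)

(* Exponential moment: give a letter [s] among the first [L] the weight [a] and
   the other letter the weight [a^-1]. *)
Lemma card_unbalanced_words (R : realFieldType) (a : R) (s : bool) n L l :
  1 <= a -> (L <= n)%N ->
  (#|[set w : {ffun 'I_n -> bool} |
       (l + \sum_(i < n | (i < L)%N) (w i != s) <=
            \sum_(i < n | (i < L)%N) (w i == s))%N]|)%:R * a ^+ l
    <= (a + a^-1) ^+ L * 2 ^+ (n - L).
Proof.
move=> a1 Ln; have a0 : 0 < a by apply: lt_le_trans a1.
pose F (i : 'I_n) (b : bool) : R := if (i < L)%N then (if b == s then a else a^-1) else 1.
have F0 i b : 0 < F i b.
  by rewrite /F; case: ifP => // _; case: ifP => // _; rewrite invr_gt0.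
(* The total weight of all words factors over the positions: [a + a^-1] for each of the first [L],
   and 2 for each of the others. *)
have -> : (a + a^-1) ^+ L * 2 ^+ (n - L) =
    \sum_(w : {ffun 'I_n -> bool}) \prod_i F i (w i).
  rewrite -(bigA_distr_bigA F) (bigID (fun i : 'I_n => (i < L)%N)) /=.
  have Fs (i : 'I_n) : \sum_b F i b = if (i < L)%N then a + a^-1 else 2.
    rewrite big_bool /F; case: ifP => // _; case: s {F F0} => //=.
    by rewrite addrC.
  rewrite (eq_bigr (fun=> a + a^-1)); last by move=> i iL; rewrite Fs iL.
  rewrite [X in _ = _ * X](eq_bigr (fun=> 2)); last first.
    by move=> i iL; rewrite Fs (negPf iL).
  have cL : (\sum_(i < n | i < L) 1 = L)%N.
    by rewrite -(big_ord_widen n (fun=> 1%N)) // sum1_card card_ord.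
  have cn : (\sum_(i < n | ~~ (i < L)) 1 = n - L)%N.
    have : (\sum_(i < n | (i < L)%N) 1 + \sum_(i < n | ~~ (i < L)%N) 1 = n)%N.
      by rewrite -[RHS]card_ord -sum1_card [RHS](bigID (fun i : 'I_n => (i < L)%N)).
    by rewrite cL => H; apply: (@addnI L); rewrite H subnKC.
  by rewrite !prodr_const -!sum1_card cL cn.
set A := [set w | _]; rewrite mulr_natl -sumr_const.
(* Markov's inequality: weights are positive, and each word of [A] has weight at least [a ^+ l]. *)
apply: (@le_trans _ _ (\sum_(w in A) \prod_i F i (w i))); last first.
  rewrite [leRHS](bigID (mem A)) /= lerDl sumr_ge0 // => w _.
  by apply: prodr_ge0 => i _; apply: ltW.
apply: ler_sum => w; rewrite inE.
set E := (\sum_(i < n | _) _)%N; set O := (\sum_(i < n | _) _)%N => le.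
have -> : \prod_i F i (w i) = a ^+ O * a^-1 ^+ E.
  rewrite /O /E -!prodrXr -big_split /= [RHS]big_mkcond; apply: eq_bigr => i _.
  by rewrite /F; case: ifP => // _; case: eqP => _; rewrite ?expr0 ?expr1 ?mulr1 ?mul1r.
rewrite exprVn ler_pdivlMr ?exprn_gt0 // -exprD.
by rewrite ler_weXn2l.
Qed.

(** The decay factor per unit of [l] for the weight [a = 1 + 1/N] and blocks of length [N * l],
    after bounding [(a + 1/a) / 2] by [1 + 1/(2 N^2)]. *)
Definition chernoff_rate (R : realFieldType) (N : nat) : R :=
  (1 + (2 * N%:R ^+ 2)^-1) ^+ N / (1 + N%:R^-1).

Lemma chernoff_rate_gt0 (R : realFieldType) N : 0 < chernoff_rate R N.
Proof.
have iN : 0 <= N%:R^-1 :> R by rewrite invr_ge0.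
rewrite divr_gt0 ?exprn_gt0 // ltr_pwDl // invr_ge0 mulr_ge0 // exprn_ge0 //.
Qed.

Lemma bernoulli (R : realFieldType) (h : R) m : -1 <= h -> 1 + m%:R * h <= (1 + h) ^+ m.
Proof.
move=> h1; elim: m => [|m IH]; first by rewrite expr0; lra.
rewrite exprSr -natr1; apply: le_trans (_ : (1 + m%:R * h) * (1 + h) <= _).
  have : 0 <= m%:R * h ^+ 2 by rewrite mulr_ge0 ?sqr_ge0.
  by nra.
by rewrite ler_wpM2r //; lra.
Qed.

(** With [x = 1/N] and [u = x^2/2], Bernoulli gives [(1 - u)^N >= 1 - x/2], hence
    [(1 + u)^N <= 1/(1 - x/2)]. This is below [1 + x] because [(1 + x)(1 - x/2) > 1] for
    [0 < x < 1]. *)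
Lemma chernoff_rate_lt1 (R : realFieldType) N : (1 < N)%N -> chernoff_rate R N < 1.
Proof.
move=> N1; set x : R := N%:R^-1.
have N0 : 0 < N%:R :> R by rewrite ltr0n; lia.
have x0 : 0 < x by rewrite invr_gt0.
have x1 : x < 1 by rewrite invf_lt1 // ltr1n.
have Nx : N%:R * x = 1 by rewrite /x mulfV // gt_eqF.
rewrite /chernoff_rate -/x; set u : R := (2 * _)^-1.
have uE : u = x ^+ 2 / 2 by rewrite /u invfM -exprVn mulrC.
have u0 : 0 <= u by rewrite uE divr_ge0 ?exprn_ge0 // ltW.
have u1 : u < 1 by rewrite uE; nra.
have B : 1 - N%:R * u <= (1 - u) ^+ N.
  by rewrite -mulrN bernoulli //; lra.
have NuE : N%:R * u = x / 2.
  by rewrite uE expr2 -!mulrA mulrA Nx mul1r.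
have P : (1 + u) ^+ N * (1 - u) ^+ N <= 1.
  rewrite -exprMn exprn_ile1 //; nra.
have P0 : 0 <= (1 + u) ^+ N by rewrite exprn_ge0 // addr_ge0.
rewrite ltr_pdivrMr ?mul1r; last by lra.
rewrite NuE in B.
have Q : (1 + u) ^+ N * (1 - x / 2) <= 1.
  by apply: le_trans P; rewrite ler_wpM2l.
by nra.
Qed.

Lemma card_unbalanced_words_rate (R : realFieldType) (s : bool) N n l :
  (1 < N)%N -> (N * l <= n)%N ->
  (#|[set w : {ffun 'I_n -> bool} |
       (l + \sum_(i < n | (i < N * l)%N) (w i != s) <=
            \sum_(i < n | (i < N * l)%N) (w i == s))%N]|)%:R
    <= 2 ^+ n * chernoff_rate R N ^+ l.
Proof.
move=> N1 Ln; set x : R := N%:R^-1.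
have x0 : 0 < x by rewrite invr_gt0 ltr0n; lia.
have a1 : 1 <= 1 + x by lra.
have := card_unbalanced_words R (1 + x) s n (N * l) l a1 Ln.
rewrite -ler_pdivlMr ?exprn_gt0 //; last by lra.
move/le_trans; apply; rewrite /chernoff_rate -/x expr_div_n mulrA.
rewrite ler_wpM2r ?invr_ge0 ?exprn_ge0 //; first by lra.
rewrite -exprM -[in leRHS](subnK Ln) exprD -mulrA -exprMn mulrC.
rewrite ler_wpM2l ?exprn_ge0 // lerXn2r ?nnegrE //; first last.
- have -> : (2 * N%:R ^+ 2)^-1 = x ^+ 2 / 2 by rewrite invfM -exprVn mulrC.
  rewrite (_ : 2 * (1 + x ^+ 2 / 2) = 2 + x ^+ 2); last by field.
  rewrite -subr_ge0.
  have -> : 2 + x ^+ 2 - (1 + x + (1 + x)^-1) = x ^+ 3 / (1 + x).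
    by field; lra.
  by rewrite divr_ge0 ?exprn_ge0 //; lra.
- by rewrite mulr_ge0 // addr_ge0 // invr_ge0 mulr_ge0 // exprn_ge0.
- by rewrite addr_ge0 ?invr_ge0; lra.
Qed.

(** * Orbits with balanced blocks *)

Lemma card_F2_ffun n : #|{ffun 'I_n -> 'F_2}| = (2 ^ n)%N.
Proof. by rewrite card_ffun !card_ord. Qed.

Lemma coef_monic_of n (c : {ffun 'I_n -> 'F_2}) (i : 'I_n) : (monic_of c)`_i = c i.
Proof.
rewrite /monic_of coefD coefXn ltn_eqF // add0r coef_sum (bigD1 i) //=.
rewrite coefZ coefXn eqxx mulr1 big1 ?addr0 // => j ji.
by rewrite coefZ coefXn eq_sym (negPf (ji : (j != i :> nat))) mulr0.
Qed.

Lemma size_monic_of n (c : {ffun 'I_n -> 'F_2}) : size (monic_of c) = n.+1.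
Proof.
rewrite /monic_of size_polyDl ?size_polyXn // ltnS.
apply: (leq_trans (size_sum _ _ _)); apply/bigmax_leqP => i _.
by rewrite (leq_trans (size_scale_leq _ _)) // size_polyXn.
Qed.

Lemma monic_of_neq0 n (c : {ffun 'I_n -> 'F_2}) : monic_of c != 0.
Proof. by rewrite -size_poly_eq0 size_monic_of. Qed.

Lemma deg_monic_of n (c : {ffun 'I_n -> 'F_2}) : deg (monic_of c) = n.
Proof. by rewrite /deg size_monic_of. Qed.

Lemma monic_of_inj n : injective (@monic_of n).
Proof. by move=> c c' E; apply/ffunP => i; rewrite -!coef_monic_of E. Qed.

Lemma monic_of_coef n (f : F2poly) : f != 0 -> deg f = n ->
  monic_of [ffun i : 'I_n => f`_i] = f.
Proof.
move=> f0 df; apply/polyP => i; have [ilt|] := ltnP i n.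
  by rewrite (coef_monic_of _ _ (Ordinal ilt)) ffunE.
rewrite leq_eqVlt => /predU1P[<-|ni].
  set c := [ffun i => _]; have := F2_lead _ (monic_of_neq0 n c).
  by have := F2_lead f f0; rewrite df deg_monic_of => -> ->.
by rewrite !nth_default // ?size_monic_of // (size_deg _ f0) df.
Qed.

(** The flag [s] names the parity in excess: [true] for odd steps, [false] for even ones. *)
Definition unbalanced (s : bool) L l (g : F2poly) : bool :=
  (l + \sum_(i < L) (odd_at1 (iter i T g) != s) <=
       \sum_(i < L) (odd_at1 (iter i T g) == s))%N.

(** The parities from time [k] come first, so that for [L <= d] the first [L] letters are exactly
    the block following time [k]. *)
Definition parity_word n k d (f : F2poly) : {ffun 'I_n -> bool} :=
  [ffun i : 'I_n => if (i < d)%N then odd_at1 (iter (k + i) T f)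
                    else odd_at1 (iter (i - d) T f)].

Lemma card_unbalanced_iter (R : realFieldType) s N n l k d :
  (1 < N)%N -> (N * l <= d)%N -> (d <= n)%N ->
  (#|[set c : {ffun 'I_n -> 'F_2} | (deg (iter k T (monic_of c)) == d) &&
        unbalanced s (N * l) l (iter k T (monic_of c))]|)%:R
  <= 2 ^+ n * chernoff_rate R N ^+ l.
Proof.
move=> N1 Ld dn; have Ln := leq_trans Ld dn.
apply: le_trans (card_unbalanced_words_rate R s N n l N1 Ln); rewrite ler_nat.
set A := [set c | _]; set W := [set w | _].
pose w (c : {ffun 'I_n -> 'F_2}) := parity_word n k d (monic_of c).
have winj : {in A &, injective w}.
  move=> c c'; rewrite !inE => /andP[/eqP dc _] /andP[/eqP dc' _] /ffunP ww.
  apply: monic_of_inj; apply: (parity_word_inj n d k);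
    rewrite ?monic_of_neq0 ?deg_monic_of // => i id.
    by have := ww (Ordinal (leq_trans id dn)); rewrite !ffunE /= id.
  have i2 : (d + i < n)%N by rewrite -ltn_subRL.
  by have := ww (Ordinal i2); rewrite !ffunE /= ltnNge leq_addr /= addKn.
rewrite -(card_in_imset winj) subset_leq_card //; apply/fintype.subsetP => _ /imsetP[c cA ->].
move: cA; rewrite !inE => /andP[_]; rewrite /unbalanced.
have E (F : bool -> nat) : (\sum_(i < n | (i < N * l)%N) F (w c i) =
    \sum_(i < N * l) F (odd_at1 (iter i T (iter k T (monic_of c)))))%N.
  rewrite [RHS](big_ord_widen n (fun i => F (odd_at1 (iter i T (iter k T (monic_of c)))))) //.
  apply: eq_bigr => i iL; rewrite ffunE (leq_trans iL Ld) -iterD addnC //.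
by rewrite (E (fun b => b != s : nat)) (E (fun b => b == s : nat)).
Qed.

(** Blocks starting in degree below [L] count as balanced: the code controls only as many steps as
    the current degree. *)
Definition balanced L l (g : F2poly) : bool :=
  (L <= deg g)%N ==> ~~ unbalanced true L l g && ~~ unbalanced false L l g.

Definition balanced_orbit L l (f : F2poly) := forall k, balanced L l (iter k T f).

Lemma iter_T1 k : iter k T 1 = 1.
Proof.
elim: k => //= k ->; apply: (mulfI X1_neq0); rewrite T_mul /odd_at1 hornerC oner_eq0.
by rewrite /= !mulr1.
Qed.

Lemma iter_T_late k f : f != 0 -> ((deg f).+1 ^ 2 <= k)%N -> iter k T f = 1.
Proof.
move=> f0 kd; have [_ t] := tau_bound f f0.
by rewrite -(subnK (leq_trans t kd)) iterD iter_tau // iter_T1.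
Qed.

Lemma card_bigcup_leq (I U : finType) (B : I -> {set U}) :
  (#|\bigcup_i B i| <= \sum_i #|B i|)%N.
Proof.
elim/big_ind2: _ => [|A m C p Am Cp|//]; first by rewrite cards0.
by rewrite (leq_trans (leq_card_setU _ _)) // leq_add.
Qed.

(** Union bound over [(n + 1)^2] times, [n + 1] degrees and two signs of the imbalance. *)
Lemma card_unbalanced_orbits (R : realFieldType) N n l : (1 < N)%N -> (0 < l)%N ->
  (#|[set c : {ffun 'I_n -> 'F_2} |
      ~~ [forall k : 'I_(n.+1 ^ 2), balanced (N * l) l (iter k T (monic_of c))]]|)%:R
  <= 2 * n.+1%:R ^+ 3 * 2 ^+ n * chernoff_rate R N ^+ l.
Proof.
move=> N1 l0; set A := [set c | _].
pose B (k : 'I_(n.+1 ^ 2)) (d : 'I_n.+1) s :=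
  [set c : {ffun 'I_n -> 'F_2} | [&& (N * l <= d)%N, deg (iter k T (monic_of c)) == d &
        unbalanced s (N * l) l (iter k T (monic_of c))]].
have sub : A \subset \bigcup_(k : 'I_(n.+1 ^ 2)) \bigcup_(d : 'I_n.+1) \bigcup_(s : bool) B k d s.
  apply/fintype.subsetP => c; rewrite inE negb_forall => /existsP[k].
  rewrite negb_imply -negb_or negbK => /andP[Ld un].
  have dn : (deg (iter k T (monic_of c)) < n.+1)%N.
    by have := leq_deg_iter_T k _ (monic_of_neq0 n c); rewrite deg_monic_of.
  apply/finset.bigcupP; exists k => //; apply/finset.bigcupP; exists (Ordinal dn) => //.
  by apply/finset.bigcupP; case/orP: un => un; [exists true | exists false];
    rewrite // inE /= Ld eqxx.
have Bc k d s : (#|B k d s|)%:R <= 2 ^+ n * chernoff_rate R N ^+ l.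
  have [Ld|Ld] := leqP (N * l) d.
    apply: le_trans (card_unbalanced_iter R s N n l k d N1 Ld (leq_ord d)).
    by rewrite ler_nat subset_leq_card //; apply/fintype.subsetP => c; rewrite !inE => /and3P[_ -> ->].
  rewrite (_ : B k d s = finset.set0) ?cards0; last first.
    by apply/setP => c; rewrite !inE leqNgt Ld.
  by rewrite mulr_ge0 ?exprn_ge0 // ltW // chernoff_rate_gt0.
have : (#|A| <= \sum_(k : 'I_(n.+1 ^ 2)) \sum_(d : 'I_n.+1) \sum_(s : bool) #|B k d s|)%N.
  apply: leq_trans (subset_leq_card sub) _.
  apply: leq_trans (card_bigcup_leq _ _ _) _.
  apply: leq_sum => k _; apply: leq_trans (card_bigcup_leq _ _ _) _.
  by apply: leq_sum => d _; apply: card_bigcup_leq.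
rewrite -(ler_nat R) => /le_trans; apply; rewrite !natr_sum.
apply: le_trans (ler_sum _ _) _ => [k _|].
  rewrite natr_sum; apply: ler_sum => d _; rewrite natr_sum; apply: ler_sum => s _.
  exact: Bc.
rewrite !sumr_const card_bool !card_ord -!mulrnA -[leLHS]mulr_natl !natrM.
rewrite le_eqVlt; apply/orP; left; apply/eqP; ring.
Qed.

Lemma tau_lower f : f != 0 -> (deg f <= tau f)%N.
Proof.
move=> f0; have := deg_iter_T (tau f) f f0; have := odd_even_count (tau f) f.
by rewrite iter_tau // {2}/deg size_poly1 /=; lia.
Qed.

Lemma unbalanced_true L l g :
  unbalanced true L l g = (l + even_count L g <= odd_count L g)%N.
Proof.
rewrite /unbalanced /odd_count /even_count; congr (_ + _ <= _)%N.
  by apply: eq_bigr => i _; case: odd_at1.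
by apply: eq_bigr => i _; case: odd_at1.
Qed.

Lemma unbalanced_false L l g :
  unbalanced false L l g = (l + odd_count L g <= even_count L g)%N.
Proof.
rewrite /unbalanced /odd_count /even_count; congr (_ + _ <= _)%N.
  by apply: eq_bigr => i _; case: odd_at1.
by apply: eq_bigr => i _; case: odd_at1.
Qed.

(** Before time [L <= deg f] fewer than [deg f] even steps have occurred, so the degree is still
    positive and 1 has not been reached. *)
Lemma tau_block L f : f != 0 -> (0 < L)%N -> (L <= deg f)%N ->
  tau f = (L + tau (iter L T f))%N.
Proof.
move=> f0 L0 Ld.
have [s _] := tau_bound _ (iter_T_neq0 L f f0).
have [|//] := stop_time_iter L f _ s.
move=> i iL; apply: (deg_iter_ne1 i f f0) => //.
by have := deg_iter_T i f f0; have := odd_even_count i f; lia.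
Qed.

(* Within a balanced block the excess of odd over even steps is less than [l],
   hence at most [2 / P] times the number of even steps, that is, of the degree lost. *)
Lemma balanced_tau P l f : (0 < P)%N -> (0 < l)%N -> f != 0 ->
  balanced_orbit (P.+1 * l) l f ->
  (P * tau f <= P * (2 * deg f) + (2 * deg f + P * (P.+1 * l) ^ 2))%N /\
  (P * (2 * deg f) <= P * tau f + (2 * deg f + P * (P.+1 * l) ^ 2))%N.
Proof.
move=> P0 l0; set L := (P.+1 * l)%N.
have L0 : (0 < L)%N by rewrite muln_gt0.
have [n] := ubnP (deg f); elim: n f => // n IH f dn f0 bal.
(* Below degree [L] the quadratic bound on [tau] is absorbed by the error [L ^ 2], which is paid
   only once, at the end of the recursion. *)
have [dL|Ld] := ltnP (deg f) L.
  have [_ hi] := tau_bound f f0; have lo := tau_lower f f0.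
  have sq : ((deg f).+1 ^ 2 <= L ^ 2)%N by rewrite leq_exp2r.
  have sq1 : (deg f <= (deg f).+1 ^ 2)%N by rewrite expnS expn1; nia.
  have A : (tau f <= 2 * deg f + L ^ 2)%N by lia.
  have B : (2 * deg f <= tau f + L ^ 2)%N by lia.
  have := leq_mul (leqnn P) A; have := leq_mul (leqnn P) B.
  by rewrite !mulnDr; lia.
have := bal 0%N; rewrite /balanced /= Ld unbalanced_true unbalanced_false /=.
rewrite -!ltnNge => /andP[b1 b2].
have dE := deg_iter_T L f f0; have oe := odd_even_count L f.
have LE : L = (P * l + l)%N by rewrite /L mulSn addnC.
have Pl : (0 < P * l)%N by rewrite muln_gt0 P0.
have e0 : (0 < even_count L f)%N by lia.
have [|||i1 i2] := IH (iter L T f); rewrite ?iter_T_neq0 //; first lia.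
  by move=> k; rewrite -iterD; apply: bal.
rewrite (tau_block L f f0 L0 Ld).
(* With [e] even steps, balance gives [P l + l = L < 2 e + l], so [P l < 2 e]. *)
have c1 : (P * odd_count L f <= P * even_count L f + 2 * even_count L f)%N.
  have : (P * odd_count L f <= P * (even_count L f + l))%N by rewrite leq_mul2l; lia.
  by rewrite mulnDr; lia.
have c2 : (P * even_count L f <= P * odd_count L f + 2 * even_count L f)%N.
  have : (P * even_count L f <= P * (odd_count L f + l))%N by rewrite leq_mul2l; lia.
  by rewrite mulnDr; lia.
have PL : (P * L = P * odd_count L f + P * even_count L f)%N by rewrite -mulnDr oe.
rewrite dE; clear -i1 i2 c1 c2 PL.
by split; nia.
Qed.

(** * Averages *)

Local Open Scope classical_set_scope.

(** From time [(deg f + 1)^2] on the orbit sits at 1, whose degree 0 is below [L], so finitely many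
    times suffice. *)
Lemma balanced_orbit_bounded L l f : (0 < L)%N -> f != 0 ->
  [forall k : 'I_((deg f).+1 ^ 2), balanced L l (iter k T f)] -> balanced_orbit L l f.
Proof.
move=> L0 f0 /forallP H k; have [kn|nk] := ltnP k ((deg f).+1 ^ 2).
  exact: (H (Ordinal kn)).
by rewrite (iter_T_late k f f0 nk) /balanced {1}/deg size_poly1 leqNgt L0.
Qed.

Lemma tau_dist_bound (R : realType) f : f != 0 ->
  `|(tau f)%:R - 2 * (deg f)%:R| <= (deg f).+1%:R ^+ 2 :> R.
Proof.
move=> f0; have [_ hi] := tau_bound f f0; have lo := tau_lower f f0.
have sq : (deg f <= (deg f).+1 ^ 2)%N by rewrite expnS expn1; nia.
rewrite -natrX -natrM ler_norml lerBlDr -natrD ler_nat.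
rewrite lerNl opprB lerBlDr -natrD ler_nat; apply/andP; split; lia.
Qed.

Lemma tau_dist_balanced (R : realType) P l f : (0 < P)%N -> (0 < l)%N -> f != 0 ->
  balanced_orbit (P.+1 * l) l f ->
  `|(tau f)%:R - 2 * (deg f)%:R| <=
    2 / P%:R * (deg f)%:R + (P.+1 * l)%N%:R ^+ 2 :> R.
Proof.
move=> P0 l0 f0 bal; have [] := balanced_tau P l f P0 l0 f0 bal.
move: (P.+1 * l)%N {bal} => L.
rewrite -!(ler_nat R) !natrD !natrM => i1 i2.
have P0' : 0 < P%:R :> R by rewrite ltr0n.
rewrite -(ler_pM2l P0') -[X in X * `|_|](gtr0_norm P0') -normrM ler_norml.
have -> : P%:R * (2 / P%:R * (deg f)%:R + L%:R ^+ 2) =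
    2 * (deg f)%:R + P%:R * L%:R ^+ 2 :> R.
  by field; rewrite gt_eqF.
by rewrite !mulrBr; apply/andP; split; lra.
Qed.

(** Balanced orbits contribute at most [K] each. Exceptional ones cost at most [(n + 1)^2] each,
    which with the [(n + 1)^3] of the union bound makes the fifth power. *)
Lemma mean_tau_dist (R : realType) P l n : (0 < P)%N -> (0 < l)%N ->
  `|rho R n - 2 * n%:R| <= 2 / P%:R * n%:R + (P.+1 * l)%N%:R ^+ 2
     + 2 * n.+1%:R ^+ 5 * chernoff_rate R P.+1 ^+ l.
Proof.
move=> P0 l0; set K : R := 2 / _ * _ + _; set q := chernoff_rate _ _.
have K0 : 0 <= K by rewrite addr_ge0 ?exprn_ge0 // mulr_ge0 // divr_ge0.
set A := [set c : {ffun 'I_n -> 'F_2} |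
  ~~ [forall k : 'I_(n.+1 ^ 2), balanced (P.+1 * l) l (iter k T (monic_of c))]]%SET.
have p2 : 0 < 2 ^+ n :> R by rewrite exprn_gt0.
have -> : rho R n - 2 * n%:R = (2 ^+ n)^-1 *
    \sum_(c : {ffun 'I_n -> 'F_2}) ((tau (monic_of c))%:R - 2 * n%:R).
  rewrite sumrB sumr_const card_F2_ffun mulrBr /rho /rho_gen; congr (_ - _).
  by rewrite -[_ *+ (2 ^ n)]mulr_natl natrX mulKf // gt_eqF.
rewrite normrM gtr0_norm ?invr_gt0 // ler_pdivrMl //.
apply: le_trans (ler_norm_sum _ _ _) _.
have H (c : {ffun 'I_n -> 'F_2}) : `|(tau (monic_of c))%:R - 2 * n%:R| <=
    K + (if c \in A then n.+1%:R ^+ 2 else 0) :> R.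
  have c0 := monic_of_neq0 n c; case: ifPn => [_|].
    apply: ler_wpDl => //.
    by have := tau_dist_bound R _ c0; rewrite deg_monic_of.
  rewrite inE negbK addr0 => bal.
  have := tau_dist_balanced R P l _ P0 l0 c0; rewrite deg_monic_of; apply.
  by apply: balanced_orbit_bounded; rewrite ?muln_gt0 // deg_monic_of.
apply: le_trans (ler_sum _ (fun c _ => H c)) _.
rewrite big_split /= sumr_const card_F2_ffun -big_mkcond sumr_const /= -[K *+ _]mulr_natl natrX.
rewrite [leRHS]mulrDr lerD2l -[leLHS]mulr_natl.
have := card_unbalanced_orbits R P.+1 n l (P0 : (1 < P.+1)%N) l0; rewrite -/A -/q => cA.
have n0 : 0 <= n.+1%:R ^+ 2 :> R by rewrite exprn_ge0.
apply: le_trans (ler_wpM2r n0 cA) _.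
rewrite le_eqVlt; apply/orP; left; apply/eqP; ring.
Qed.

Lemma geometric_le_harmonic (R : realFieldType) (q : R) m : 0 < q -> q < 1 -> (0 < m)%N ->
  q ^+ m <= (m%:R * (q^-1 - 1))^-1.
Proof.
move=> q0 q1 m0; have h0 : 0 < q^-1 - 1 by rewrite subr_gt0 invf_gt1.
have m0' : 0 < m%:R :> R by rewrite ltr0n.
rewrite -[q in q ^+ m]invrK exprVn lef_pV2 ?posrE ?exprn_gt0 ?invr_gt0 ?mulr_gt0 //.
have h1 : -1 <= q^-1 - 1 by lra.
have := bernoulli R (q^-1 - 1) m h1; rewrite [1 + (_ - 1)]addrC subrK.
by apply: le_trans; rewrite lerDr.
Qed.

(* Blocks of length about [n ^ (1 / 3)]: long enough for the failure probability to beat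
   the polynomial factors, short enough for [L ^ 2 = o(n)]. *)
Lemma mean_tau_rate (R : realType) P : (0 < P)%N -> exists2 C : R, 0 < C &
  forall m n : nat, (0 < m)%N -> (m ^ 3 <= n)%N -> (n < m.+1 ^ 3)%N ->
    `|rho R n / n%:R - 2| <= 2 / P%:R + C / m%:R.
Proof.
move=> P0; set q := chernoff_rate R P.+1.
have q0 : 0 < q := chernoff_rate_gt0 R P.+1.
have q1 : q < 1 := chernoff_rate_lt1 R P.+1 P0.
have h0 : 0 < q^-1 - 1 by rewrite subr_gt0 invf_gt1.
(* Take [l = 16 m]. Then [L^2] is of order [m^2 <= n/m], while [(n + 1)^5 <= (2 m)^15] is beaten by
   [q^(16 m) <= (m (1/q - 1))^(-16)], leaving a single factor [1/m]. *)
exists ((P.+1 * 16)%N%:R ^+ 2 + 2 ^+ 16 / (q^-1 - 1) ^+ 16).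
  by rewrite addr_gt0 // ?divr_gt0 // ?exprn_gt0 // ltr0n muln_gt0.
move=> m n m0 mn nm.
have n0 : 0 < n%:R :> R by rewrite ltr0n (leq_trans _ mn) // expn_gt0 m0.
have m0' : 0 < m%:R :> R by rewrite ltr0n.
have l0 : (0 < 16 * m)%N by rewrite muln_gt0.
have := mean_tau_dist R P (16 * m) n P0 l0; rewrite -/q => H.
have -> : rho R n / n%:R - 2 = (rho R n - 2 * n%:R) / n%:R.
  by field; rewrite gt_eqF.
rewrite normrM [`|n%:R^-1|]gtr0_norm ?invr_gt0 //.
rewrite ler_pdivrMr // (le_trans H) // [leRHS]mulrDl -addrA lerD2l.
rewrite [X in _ <= X * _]mulrDl [leRHS]mulrDl lerD //.
  rewrite mulnA natrM exprMn -[leRHS]mulrA ler_wpM2l ?exprn_ge0 // [leRHS]mulrC.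
  by rewrite ler_pdivlMr // -exprSr -natrX ler_nat.
have n1 : 1 <= n%:R :> R by rewrite ler1n -(ltr0n R).
apply: le_trans (ler_peMr _ n1); last by rewrite !divr_ge0 ?exprn_ge0 // ltW.
have b1 : n.+1%:R ^+ 5 <= (2 * m%:R) ^+ 15 :> R.
  rewrite -[15%N]/(3 * 5)%N exprM lerXn2r ?nnegrE ?exprn_ge0 ?mulr_ge0 //.
  rewrite -natrM -natrX ler_nat (leq_trans nm) // leq_exp2r //; lia.
have b2 : q ^+ (16 * m) <= (m%:R * (q^-1 - 1))^-1 ^+ 16.
  rewrite mulnC exprM lerXn2r ?nnegrE ?geometric_le_harmonic //.
    by rewrite exprn_ge0 // ltW.
  by rewrite invr_ge0 mulr_ge0 // ltW.
apply: le_trans (_ : 2 * (2 * m%:R) ^+ 15 * (m%:R * (q^-1 - 1))^-1 ^+ 16 <= _).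
  apply: ler_pM => //; last by rewrite ler_pM2l.
    by rewrite mulr_ge0 // exprn_ge0.
  by rewrite exprn_ge0 // ltW.
rewrite le_eqVlt; apply/orP; left; apply/eqP; move: (q^-1 - 1) h0 => h h0.
by field; rewrite !gt_eqF.
Qed.

Lemma cube_root n : exists m, (m ^ 3 <= n)%N /\ (n < m.+1 ^ 3)%N.
Proof.
elim: n => [|n [m [mn nm]]]; first by exists 0%N.
have [|nm'] := ltnP n.+1 (m.+1 ^ 3); first by exists m; rewrite (leq_trans mn).
exists m.+1; split=> //; rewrite (leq_ltn_trans nm) // ltn_exp2r //.
Qed.

Lemma rho_cvg (R : realType) : (fun n : nat => rho R n / n%:R) @ \oo --> (2%:R : R).
Proof.
apply/cvgrPdist_le => e e0.
pose P := (Num.truncn (4 / e)).+1.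
have P0 : 0 < P%:R :> R by rewrite ltr0n.
have Pe : 2 / P%:R <= e / 2.
  have : 4 / e < P%:R by rewrite truncnS_gt.
  rewrite ltr_pdivrMr // ler_pdivrMr // => ?; nra.
have [C C0 HC] := mean_tau_rate R P isT.
pose m0 := (Num.truncn (2 * C / e)).+1.
have m0e : C / m0%:R <= e / 2.
  have : 2 * C / e < m0%:R by rewrite truncnS_gt.
  rewrite ltr_pdivrMr // ler_pdivrMr ?ltr0n // => ?; nra.
exists (m0 ^ 3)%N => // n /= mn.
have [m [mlo mhi]] := cube_root n.
(* From [m0^3 <= n < (m + 1)^3]. *)
have m0m : (m0 <= m)%N.
  by rewrite -ltnS -(@ltn_exp2r _ _ 3) // (leq_ltn_trans mn).
rewrite distrC (le_trans (HC m n _ mlo mhi)) ?(leq_trans _ m0m) //.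
have : C / m%:R <= C / m0%:R.
  by rewrite ler_pM2l // lef_pV2 ?posrE ?ltr0n ?(leq_trans _ m0m) // ler_nat.
lra.
Qed.

(** * The map [T0] *)

(** An involution exchanging ['X] and ['X + 1], hence the evaluation points 0 and 1 that decide the
    branches of [T0] and [T]. *)
Definition shift1 (f : F2poly) : F2poly := f \Po ('X + 1).

Lemma shift1M f g : shift1 (f * g) = shift1 f * shift1 g.
Proof. exact: comp_polyM. Qed.

Lemma shift1D f g : shift1 (f + g) = shift1 f + shift1 g.
Proof. exact: comp_polyD. Qed.

Lemma shift1_1 : shift1 1 = 1.
Proof. exact: comp_polyC. Qed.

Lemma shift1_X : shift1 'X = 'X + 1.
Proof. exact: comp_polyX. Qed.

Lemma shift1K : involutive shift1.
Proof.
move=> f; rewrite /shift1 -comp_polyA comp_polyD comp_polyX comp_polyC.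
by rewrite -addrA F2poly_addpp addr0 comp_polyXr.
Qed.

Lemma size_shift1 f : size (shift1 f) = size f.
Proof. by rewrite /shift1 size_comp_poly2 // size_X1. Qed.

Lemma shift1_X1 : shift1 ('X + 1) = 'X.
Proof. by rewrite shift1D shift1_X shift1_1 -addrA F2poly_addpp addr0. Qed.

Lemma shift1_at0 f : ((shift1 f).[0] == 0) = ~~ odd_at1 f.
Proof. by rewrite /odd_at1 negbK horner_comp !hornerE. Qed.

Lemma T0_shift1_even f : ~~ odd_at1 f -> T0 (shift1 f) = shift1 (T f).
Proof.
move=> ev; rewrite /T0 shift1_at0 ev; have := T_mul f; rewrite (negPf ev) => {1}<-.
by rewrite shift1M shift1_X1 mulrC mulpK // polyX_eq0.
Qed.

Lemma T0_shift1_odd f : odd_at1 f -> T0 (shift1 f) = 'X * shift1 (T f).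
Proof.
move=> od; rewrite /T0 shift1_at0 od /=.
have := congr1 shift1 (T_mul f).
by rewrite od shift1M shift1_X1 shift1D shift1M shift1_X shift1_1 => <-.
Qed.

Lemma T0_mulX f : T0 ('X * f) = f.
Proof. by rewrite /T0 !hornerE eqxx mulrC mulpK // polyX_eq0. Qed.

(** Induction on [tau f]: an even step adds one to [tau0] and one to the degree, an odd step adds
    two to [tau0] only. Either way the left side grows by two. *)
Lemma tau0_shift1 f : f != 0 ->
  stops T0 (shift1 f) /\ (tau0 (shift1 f) + deg f = 2 * tau f)%N.
Proof.
move=> f0; have [n] := ubnP (tau f); elim: n f f0 => // n IH f f0 tn.
have [f1|f1] := eqVneq f 1.
  rewrite f1 shift1_1 /tau0 /tau !stop_time1 /deg size_poly1; split=> //.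
  by exists 0%N.
have Tf0 := T_neq0 f f0; have [sT _] := tau_bound _ Tf0.
have [_ tT] := stop_timeS T f f1 sT; rewrite -!/(tau _) in tT.
have [|s0 t0] := IH (T f) Tf0; first by rewrite tT in tn.
have dT := deg_T f f0.
have sf1 : shift1 f != 1.
  apply: contra_neq f1 => /(congr1 shift1); by rewrite shift1K shift1_1.
have [od|ev] := boolP (odd_at1 f); rewrite ?od ?(negPf ev) /= in dT.
  (* The intermediate point of the double step has zero constant term, so [T0] does not stop
     there. *)
  have X1 : 'X * shift1 (T f) != 1.
    apply: contra_neq (oner_neq0 'F_2) => /(congr1 (fun p : F2poly => p.[0])).
    by rewrite !hornerE => <-.
  have := stop_timeS T0 _ X1; rewrite T0_mulX => /(_ s0) [s1 t1].
  have := stop_timeS T0 _ sf1; rewrite T0_shift1_odd // => /(_ s1) [s2 t2].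
  by split=> //; rewrite /tau0 in t0 *; rewrite t2 t1 tT; lia.
have := stop_timeS T0 _ sf1; rewrite T0_shift1_even // => /(_ s0) [s1 t1].
by split=> //; rewrite /tau0 in t0 *; rewrite t1 tT; lia.
Qed.

(** Since [shift1] permutes the polynomials of degree [n], the sum of [tau0] can be reindexed by the
    induced permutation [h] of coefficient vectors. *)
Lemma rho0E (R : realType) n : rho0 R n = 2 * rho R n - n%:R.
Proof.
pose h (c : {ffun 'I_n -> 'F_2}) := [ffun i : 'I_n => (shift1 (monic_of c))`_i].
have hE c : monic_of (h c) = shift1 (monic_of c).
  apply: monic_of_coef; first by rewrite -size_poly_eq0 size_shift1 size_monic_of.
  by rewrite /deg size_shift1 size_monic_of.
have hinj : injective h.
  move=> c c' /(congr1 (@monic_of n)); rewrite !hE => /(inv_inj shift1K).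
  exact: monic_of_inj.
rewrite /rho0 /rho /rho_gen (reindex_inj hinj) /=.
have E c : (tau0 (monic_of (h c)))%:R = 2 * (tau (monic_of c))%:R - n%:R :> R.
  have [_] := tau0_shift1 _ (monic_of_neq0 n c); rewrite deg_monic_of -hE => E.
  by rewrite -natrM -E natrD addrK.
under eq_bigr do rewrite E.
rewrite sumrB sumr_const card_F2_ffun -mulr_sumr mulrBr mulrCA; congr (_ - _).
by rewrite -[n%:R *+ _]mulr_natl natrX mulKf // gt_eqF // exprn_gt0.
Qed.

Theorem theorem2p14 (R : realType) :
  ((fun n : nat => rho R n / n%:R) @ \oo --> (2%:R : R)) /\
  ((fun n : nat => rho0 R n / n%:R) @ \oo --> (3%:R : R)).
Proof.
split; first exact: rho_cvg.
apply/cvgrPdist_le => e e0; have e2 : 0 < e / 2 by rewrite divr_gt0.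
have /cvgrPdist_le/(_ _ e2) H := rho_cvg R.
near=> n.
have n0 : 0 < n%:R :> R by rewrite ltr0n; near: n; exact: nbhs_infty_gt.
have Hn : `|2 - rho R n / n%:R| <= e / 2 by near: n.
(* The error for [rho0] is exactly twice that for [rho], whence the tolerance [e / 2]. *)
have -> : 3%:R - rho0 R n / n%:R = 2 * (2 - rho R n / n%:R).
  by rewrite rho0E; field; rewrite gt_eqF.
by rewrite normrM ger0_norm //; lra.
Unshelve. all: by end_near.
Qed.
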